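(* Let $A$ be a Noetherian integral domain. The following conditions are equivalent. (1) $A$ is a Dedekind domain. (2) For every $n\ge 1$ and every multiset $[\mathfrak{a}_1,\ldots,\mathfrak{a}_n]$ of ideals of $A$, both of the following equalities hold: $$( * )_n\qquad G(n)\,L(2)\,L(4)\cdots L(2\lfloor n/2\rfloor)=L(1)\,L(3)\cdots L(2\lceil n/2\rceil-1),$$ $$( ** )_n\qquad L(n)\,G(2)\,G(4)\cdots G(2\lfloor n/2\rfloor)=G(1)\,G(3)\cdots G(2\lceil n/2\rceil-1).$$ (3) For every pair $[\mathfrak{a}_1,\mathfrak{a}_2]$ of ideals of $A$, $$(\mathfrak{a}_1\cap\mathfrak{a}_2)(\mathfrak{a}_1+\mathfrak{a}_2)=\mathfrak{a}_1\mathfrak{a}_2.$$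
   Context: An integral domain is commutative with unity. A multiset is a finite list up to permutation, so repetitions are allowed. For ideals $\mathfrak{a}_1,\ldots,\mathfrak{a}_n$ of $A$ and $1\le k\le n$, put $$G(k)=\prod_{\{i_1,\ldots,i_k\}}(\mathfrak{a}_{i_1}+\cdots+\mathfrak{a}_{i_k}),\qquad L(k)=\prod_{\{i_1,\ldots,i_k\}}(\mathfrak{a}_{i_1}\cap\cdots\cap\mathfrak{a}_{i_k}),$$ where both products (of ideals) are over all subsets $\{i_1,\ldots,i_k\}$ of $\{1,\ldots,n\}$ with exactly $k$ distinct elements. The products $L(2)L(4)\cdots$ and $G(2)G(4)\cdots$ run over all even indices $k$ with $2\le k\le n$, and $L(1)L(3)\cdots$ and $G(1)G(3)\cdots$ over all odd indices $k$ with $1\le k\le n$; an empty product is simply omitted. Let $K$ be the field of fractions of $A$. A fractional ideal is an $A$-submodule $\mathfrak{a}\subset K$ for which there is $r\in A\setminus\{0\}$ with $r\mathfrak{a}\subset A$; the product $\mathfrak{a}\mathfrak{b}$ is the set of finite sums of products of elements of $\mathfrak{a}$ and $\mathfrak{b}$. $A$ is called a Dedekind domain if the non-zero fractional ideals form a group under this multiplication (so fields count as Dedekind domains). *)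

(* Defs.v *)
From HB Require Import structures.
From mathcomp Require Import all_boot all_order all_algebra.
From mathcomp Require Import mathcomp_extra boolp classical_sets.

Set Implicit Arguments.
Unset Strict Implicit.
Unset Printing Implicit Defensive.

Import GRing.Theory.
Local Open Scope ring_scope.
Local Open Scope classical_set_scope.

Definition sumset (R : pzRingType) (I J : set R) : set R :=
  [set x + y | x in I & y in J].

(* Used both for ideals of A (R := A) and for fractional ideals
   (R := the fraction field of A). *)
Definition prodset (R : pzRingType) (I J : set R) : set R :=
  [set x | exists (m : nat) (a b : 'I_m -> R),
     (forall i, I (a i) /\ J (b i)) /\ x = \sum_(i < m) a i * b i].

(* MathComp's idealr_closed excludes the unit ideal, which is allowed here. *)
Definition is_ideal (A : comPzRingType) (I : set A) : Prop :=
  [/\ I 0, forall x y, I x -> I y -> I (x + y)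
    & forall r x, I x -> I (r * x)].

Definition noetherian (A : comPzRingType) : Prop :=
  forall I : set A, is_ideal I ->
    exists s : seq A,
      I = [set x | exists c : 'I_(size s) -> A,
                     x = \sum_(i < size s) c i * s`_i].

Definition is_fractional_ideal (A : idomainType) (I : set {fraction A}) : Prop :=
  [/\ I 0, forall x y, I x -> I y -> I (x + y),
      forall (r : A) x, I x -> I (FracField.tofrac r * x)
    & exists2 r : A, r != 0 &
        forall x, I x -> exists y : A, FracField.tofrac r * x = FracField.tofrac y].

Definition forms_group (T : Type) (S : set T) (op : T -> T -> T) : Prop :=
  [/\ forall x y, S x -> S y -> S (op x y),
      forall x y z, S x -> S y -> S z -> op x (op y z) = op (op x y) z
    & exists e, [/\ S e,
        forall x, S x -> op e x = x /\ op x e = x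
      & forall x, S x -> exists y, [/\ S y, op x y = e & op y x = e]]].

Definition dedekind (A : idomainType) : Prop :=
  forms_group
    [set I : set {fraction A} | is_fractional_ideal I /\ I <> [set 0]]
    (@prodset {fraction A}).

(* Products of ideals start from the unit ideal setT, which is neutral for
   prodset on ideals, so an empty product may be omitted. *)
Definition Gprod (A : comPzRingType) (n : nat) (a : 'I_n -> set A) (k : nat) :
    set A :=
  \big[@prodset A/setT]_(S : {set 'I_n} | #|S| == k)
    \big[@sumset A/[set 0]]_(i in S) a i.

Definition Lprod (A : comPzRingType) (n : nat) (a : 'I_n -> set A) (k : nat) :
    set A :=
  \big[@prodset A/setT]_(S : {set 'I_n} | #|S| == k)
    \big[setI/setT]_(i in S) a i.

Definition even_prod (A : comPzRingType) (n : nat) (F : nat -> set A) : set A :=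
  \big[@prodset A/setT]_(2 <= k < n.+1 | ~~ odd k) F k.

Definition odd_prod (A : comPzRingType) (n : nat) (F : nat -> set A) : set A :=
  \big[@prodset A/setT]_(1 <= k < n.+1 | odd k) F k.

(* Main.v *)
Require Import Defs.
From HB Require Import structures.
From mathcomp Require Import all_boot all_order all_algebra.
From mathcomp Require Import mathcomp_extra boolp classical_sets.

Set Implicit Arguments.
Unset Strict Implicit.
Unset Printing Implicit Defensive.

Import GRing.Theory.
Local Open Scope ring_scope.
Local Open Scope classical_set_scope.

(** The proof rests on one notion: an ideal I is invertible when some ideal J
and some d != 0 satisfy I J = dA.  Clearing denominators, A is Dedekind exactly
when every non-zero ideal is invertible ([dedekind_invertible]), so that all the
arithmetic takes place inside A, and an inclusion of ideals may be checked
after multiplying both sides by d.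

From (1) to (2).  When non-zero ideals are invertible, the ideals behave like
a cone in a lattice-ordered abelian group with join I + J and meet
I `&` J: one has (I + J)(I `&` J) = IJ ([setI_sumset_prodset]), and sum and
intersection distribute over each other ([setI_sumsetl], [sumset_setIl]).  These
laws alone give the analogue of
  max = sum of the minima over the odd subsets
        - sum of the minima over the non-empty even subsets,
written multiplicatively and without inverses ([inclusion_exclusion]).  The laws
hold for the zero ideal too, and they are symmetric in sum and intersection, so
the two families of identities are the same lemma used twice.

From (2) to (3), the first identity for n = 2 is the statement: G(2) and
L(2) have one factor each, and L(1) is the product of the two ideals.

From (3) to (1).  If I and J are invertible then so is IJ, which by (3) has
I + J as a factor; a factor of an invertible ideal is invertible.  Hence every
non-zero finitely generated ideal, being a sum of principal ideals, is
invertible ([noetherian_invertible]). *)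

(** * Inclusion-exclusion for two semilattice operations and a product *)

(** The subsets of x |: V come in two kinds: those avoiding x are the subsets of
V, those containing x are the x |: S with S a subset of V. *)
Lemma big_subsetU1 (T : Type) (one : T) (mul : Monoid.com_law one)
    (I : finType) (x : I) (V : {set I}) (P : pred {set I})
    (F : {set I} -> T) : x \notin V ->
  \big[mul/one]_(S : {set I} | (S \subset x |: V) && P S) F S =
  mul (\big[mul/one]_(S : {set I} | (S \subset V) && P S) F S)
      (\big[mul/one]_(S : {set I} | (S \subset V) && P (x |: S)) F (x |: S)).
Proof.
move=> xV.
have sub_notin (S : {set I}) : S \subset V -> x \notin S.
  by move=> SV; apply: contra xV; apply: (fintype.subsetP SV).
rewrite (bigID (fun S : {set I} => x \in S)) /= Monoid.mulmC; congr (mul _ _).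
  apply: eq_bigl => S; case: (boolP (S \subset V)) => SV /=.
    rewrite (fintype.subset_trans SV (finset.subsetU1 x V)) sub_notin //.
    by rewrite andbT.
  apply/negbTE; apply: contra SV => /andP[/andP[SxV _] xS].
  by apply/fintype.subsetP => y yS; have := fintype.subsetP SxV y yS;
     rewrite !inE => /orP[/eqP yx|//]; rewrite -yx yS in xS.
rewrite (reindex_onto (fun S => x |: S) (fun S => S :\ x)) /=; last first.
  by move=> S /andP[_ xS]; rewrite finset.setD1K.
apply: eq_bigl => S; rewrite finset.setU11 andbT.
apply/idP/idP => [/andP[/andP[sub ->] /eqP <-]|/andP[SV ->]].
  by rewrite andbT finset.subDset.
by rewrite finset.setU1K ?eqxx ?sub_notin // finset.setUS.
Qed.

(** The induction adds one index x to V.  The subsets of x |: V containing x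
contribute the terms of the family F' i := meet (F i) (F x) indexed by V,
together with F x itself, and by distributivity the join of F' is meet J (F x),
where J is the join of F over V.  The induction hypotheses for F and for F'
then reduce the claim to mul (join J (F x)) (meet J (F x)) = mul J (F x).  The
identities are multiplied and never divided, so that the lemma applies to ideals
that may vanish. *)
Lemma inclusion_exclusion (T : Type) (one j0 m0 : T)
    (mul : Monoid.com_law one) (join : Monoid.com_law j0)
    (meet : Monoid.com_law m0) :
    idempotent_op meet -> left_zero j0 meet -> left_distributive meet join ->
    (forall x y, mul (join x y) (meet x y) = mul x y) ->
  forall (I : finType) (U : {set I}) (F : I -> T), U != finset.set0 ->
  mul (\big[join/j0]_(i in U) F i)
      (\big[mul/one]_(S : {set I} | (S \subset U) &&
                                    ((S != finset.set0) && ~~ odd #|S|))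
         \big[meet/m0]_(i in S) F i) =
  \big[mul/one]_(S : {set I} | (S \subset U) && odd #|S|)
     \big[meet/m0]_(i in S) F i.
Proof.
move=> meetxx meet0 meetDl joinM_meet I U.
have [m] := ubnP #|U|; elim: m U => // m IHm U; rewrite ltnS => leUm F.
case/finset.set0Pn => x xU.
have xV : x \notin U :\ x by rewrite !inE eqxx.
rewrite -(finset.setD1K xU); set V := U :\ x in xV *.
have [->|V0] := eqVneq V finset.set0.
  rewrite !big_subsetU1 ?inE // !big_setU1 ?inE //=.
  have E0 (P : pred {set I}) (G : {set I} -> T) :
    \big[mul/one]_(S : {set I} | (S \subset finset.set0) && P S) G S =
    if P finset.set0 then G finset.set0 else one.
    rewrite (eq_bigl (fun S => (S == finset.set0) && P S)); last first.
      by move=> S; rewrite finset.subset0.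
    by rewrite big_mkcondr big_pred1_eq.
  rewrite !E0 eqxx cards0 /= finset.setU0 cards1 /= !big_set0 big_set1 andbF.
  by rewrite !Monoid.mulm1 !Monoid.mul1m.
have cardV : (#|V| < m)%N.
  by apply: leq_trans leUm; rewrite /V [#|U|](cardsD1 x) xU.
have IH := IHm V cardV.
pose F' i := meet (F i) (F x).
have meetF' (S : {set I}) : S != finset.set0 -> x \notin S ->
    \big[meet/m0]_(i in x |: S) F i = \big[meet/m0]_(i in S) F' i.
  move=> S0 xS; rewrite big_setU1 //= big_split /=.
  (* The meet of #|S| > 0 copies of F x is F x, by idempotence. *)
  rewrite Monoid.mulmC; congr (meet _ _); case/finset.set0Pn: S0 => y yS.
  rewrite big_const; have : (0 < #|S|)%N by rewrite (cardD1 y) yS.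
  case: #|S| => // k _; elim: k => [|k IHk]; first by rewrite /= Monoid.mulm1.
  by rewrite iterS -IHk meetxx.
have joinF' :
    \big[join/j0]_(i in V) F' i = meet (\big[join/j0]_(i in V) F i) (F x).
  have meetD a b : meet (join a b) (F x) = join (meet a (F x)) (meet b (F x)).
    exact: meetDl.
  by rewrite (big_morph (meet^~ (F x)) meetD (meet0 (F x))).
have notin (S : {set I}) : S \subset V -> x \notin S.
  by move=> SV; apply: contra xV; apply: (fintype.subsetP SV).
have odd_card (S : {set I}) : S \subset V -> odd #|x |: S| = ~~ odd #|S|.
  by move=> SV; rewrite cardsU1 notin //= oddD.
rewrite !big_subsetU1 // big_setU1 //=.
rewrite [X in mul _ (mul _ X)](_ : _ =
    \big[mul/one]_(S : {set I} | (S \subset V) && odd #|S|)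
       \big[meet/m0]_(i in S) F' i); last first.
  rewrite (eq_bigl (fun S : {set I} => (S \subset V) && odd #|S|)); last first.
    move=> S; case: (boolP (S \subset V)) => // SV; rewrite odd_card //= negbK.
    rewrite andb_idl // => _; apply/finset.set0Pn; exists x.
    by rewrite finset.setU11.
  apply: eq_bigr => S /andP[SV oS]; rewrite meetF' ?notin //.
  by apply: contraTneq oS => ->; rewrite cards0.
rewrite [X in _ = mul _ X](_ : _ = mul (F x)
    (\big[mul/one]_(S : {set I} | (S \subset V) &&
        ((S != finset.set0) && ~~ odd #|S|)) \big[meet/m0]_(i in S) F' i));
  last first.
  rewrite (bigD1 finset.set0) /=; last first.
    by rewrite finset.sub0set finset.setU0 cards1.
  rewrite finset.setU0 big_set1; congr (mul _ _).
  rewrite (eq_bigl (fun S : {set I} => (S \subset V) &&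
                     ((S != finset.set0) && ~~ odd #|S|))); last first.
    move=> S; case: (boolP (S \subset V)) => // SV; rewrite odd_card //=.
    by rewrite andbC.
  by apply: eq_bigr => S /and3P[SV S0 _]; rewrite meetF' ?notin.
rewrite -(IH F V0) -(IH F' V0) joinF'.
set J := \big[join/j0]_(i in V) F i.
have mulACA : interchange mul mul by move=> ? ? ? ?; exact: Monoid.mulmACA.
rewrite (mulACA J) -(joinM_meet J) (Monoid.mulmC join (F x) J).
rewrite -(Monoid.mulmA mul (join _ _)); congr (mul _ _).
exact: Monoid.mulmCA.
Qed.

(** * Arithmetic of products, sums and multiples of ideals *)

Section ProductOfSets.
Variable R : comPzRingType.
Implicit Types (I J K L : set R) (c d : R).

(** A product of sets is the least additively stable set containing the products
of elements ([mem_prodset], [prodset_add_stable], [sub_prodset]); this universal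
property spares the handling of explicit sums, for subsets of the field of
fractions as well as for ideals. *)
Definition add_stable L := L 0 /\ forall x y, L x -> L y -> L (x + y).

Definition scaleset c I : set R := [set c * x | x in I].

Lemma mem_prodset I J x y : I x -> J y -> prodset I J (x * y).
Proof.
by move=> Ix Jy; exists 1%N, (fun=> x), (fun=> y); rewrite big_ord1.
Qed.

Lemma prodset_add_stable I J : add_stable (prodset I J).
Proof.
split.
  by exists 0%N, (fun=> 0), (fun=> 0); split; [case | rewrite big_ord0].
move=> _ _ [m [a [b [ab ->]]]] [n [a' [b' [ab' ->]]]].
pose cat (f : 'I_m -> R) (g : 'I_n -> R) (i : 'I_(m + n)) :=
  match fintype.split i with inl j => f j | inr j => g j end.
exists (m + n)%N, (cat a a'), (cat b b').
split; first by move=> i; rewrite /cat; case: (fintype.split i).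
rewrite /cat big_split_ord; congr (_ + _); apply: eq_bigr => i _.
  by rewrite !(unsplitK (inl i)).
by rewrite !(unsplitK (inr i)).
Qed.

Lemma sub_prodset I J L : add_stable L ->
  (forall x y, I x -> J y -> L (x * y)) -> prodset I J `<=` L.
Proof.
move=> [L0 LD] IJL _ [m [a [b [ab ->]]]].
by elim/big_ind: _ => // i _; have [] := ab i; exact: IJL.
Qed.

Lemma prodsetS I I' J J' : I `<=` I' -> J `<=` J' ->
  prodset I J `<=` prodset I' J'.
Proof.
move=> II' JJ'; apply: sub_prodset; first exact: prodset_add_stable.
by move=> x y /II' I'x /JJ' J'y; exact: mem_prodset.
Qed.

Lemma prodsetC I J : prodset I J = prodset J I.
Proof.
by rewrite eqEsubset; split; apply: sub_prodset; try exact: prodset_add_stable;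
   move=> x y Ix Jy; rewrite mulrC; exact: mem_prodset.
Qed.

Lemma prodsetA I J K : prodset I (prodset J K) = prodset (prodset I J) K.
Proof.
suff le I' J' K' : prodset I' (prodset J' K') `<=` prodset (prodset I' J') K'.
  rewrite eqEsubset; split; first exact: le.
  rewrite (prodsetC _ K) (prodsetC I J) (prodsetC I (prodset _ _)).
  rewrite (prodsetC J K).
  exact: le.
have [st0 stD] := prodset_add_stable (prodset I' J') K'.
apply: sub_prodset => // x y I'x; move: y.
apply: (@sub_prodset _ _ [set y | prodset (prodset I' J') K' (x * y)]).
  split=> [|y z] /=; first by rewrite mulr0.
  by rewrite mulrDr; exact: stD.
by move=> y z J'y K'z /=; rewrite mulrA; do 2?apply: mem_prodset.
Qed.

Lemma prodsetCA I J K : prodset I (prodset J K) = prodset J (prodset I K).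
Proof. by rewrite !prodsetA (prodsetC I). Qed.

Lemma prodsetACA I J K L :
  prodset (prodset I J) (prodset K L) = prodset (prodset I K) (prodset J L).
Proof. by rewrite -!prodsetA (prodsetCA J). Qed.

Lemma scaleset_add_stable c I : add_stable I -> add_stable (scaleset c I).
Proof.
move=> [I0 ID]; split; first by exists 0; rewrite ?mulr0.
move=> _ _ [x Ix <-] [y Iy <-].
by exists (x + y); rewrite ?mulrDr //; exact: ID.
Qed.

Lemma scaleset_scaleset c d I : scaleset c (scaleset d I) = scaleset (c * d) I.
Proof.
rewrite eqEsubset; split=> [_ [_ [x Ix <-] <-]|_ [x Ix <-]].
  by exists x; rewrite ?mulrA.
by exists (d * x); rewrite ?mulrA //; exists x.
Qed.

Lemma scale1set I : scaleset 1 I = I.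
Proof.
rewrite eqEsubset; split=> [_ [x Ix <-]|x Ix]; first by rewrite mul1r.
by exists x; rewrite ?mul1r.
Qed.

Lemma prodset_scalel c I J :
  prodset (scaleset c I) J = scaleset c (prodset I J).
Proof.
have [st0 stD] := prodset_add_stable (scaleset c I) J.
rewrite eqEsubset; split.
  apply: sub_prodset.
    exact/scaleset_add_stable/prodset_add_stable.
  move=> _ y [x Ix <-] Jy; exists (x * y); last by rewrite mulrA.
  exact: mem_prodset.
move=> _ [z IJz <-]; move: z IJz.
apply: (@sub_prodset _ _ [set z | prodset (scaleset c I) J (c * z)]).
  split=> [|y z] /=; first by rewrite mulr0.
  by rewrite mulrDr; exact: stD.
by move=> x y Ix Jy /=; rewrite mulrA; apply: mem_prodset => //; exists x.
Qed.

Lemma prodset_scaler c I J :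
  prodset I (scaleset c J) = scaleset c (prodset I J).
Proof. by rewrite prodsetC prodset_scalel prodsetC. Qed.

Lemma ideal_add_stable I : is_ideal I -> add_stable I.
Proof. by case. Qed.

Lemma ideal_setT : is_ideal [set: R]. Proof. by []. Qed.

Lemma ideal_set0 : is_ideal [set 0 : R].
Proof.
by split=> //= [x y -> ->|r x ->]; rewrite ?addr0 ?mulr0.
Qed.

Lemma ideal_setI I J : is_ideal I -> is_ideal J -> is_ideal (I `&` J).
Proof.
move=> [I0 ID IM] [J0 JD JM]; split=> // [x y [Ix Jx] [Iy Jy]|r x [Ix Jx]].
  by split; [exact: ID | exact: JD].
by split; [exact: IM | exact: JM].
Qed.

Lemma ideal_sumset I J : is_ideal I -> is_ideal J -> is_ideal (sumset I J).
Proof.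
move=> [I0 ID IM] [J0 JD JM]; split.
- by exists 0 => //; exists 0; rewrite ?addr0.
- move=> _ _ [x Ix [y Jy <-]] [x' Ix' [y' Jy' <-]].
  by exists (x + x'); [exact: ID|exists (y + y'); [exact: JD|rewrite addrACA]].
- move=> r _ [x Ix [y Jy <-]]; rewrite mulrDr.
  by exists (r * x); [exact: IM | exists (r * y); first exact: JM].
Qed.

Lemma ideal_scaleset c I : is_ideal I -> is_ideal (scaleset c I).
Proof.
move=> Iid; have [? ?] := scaleset_add_stable c (ideal_add_stable Iid).
split=> // r _ [x Ix <-]; exists (r * x); last by rewrite mulrCA.
by case: Iid => _ _; apply.
Qed.

Lemma ideal_prodset I J : is_ideal I -> is_ideal (prodset I J).
Proof.
move=> [I0 ID IM]; have [? stD] := prodset_add_stable I J.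
split=> // r x IJx; move: x IJx.
apply: (@sub_prodset _ _ [set x | prodset I J (r * x)]).
  split=> [|y z] /=; first by rewrite mulr0.
  by rewrite mulrDr; exact: stD.
by move=> x y Ix Jy /=; rewrite mulrA; apply: mem_prodset => //; exact: IM.
Qed.

Lemma prodset_subr I J : is_ideal J -> prodset I J `<=` J.
Proof.
by move=> [J0 JD JM]; apply: sub_prodset => // x y _; exact: JM.
Qed.

Lemma prodset_subl I J : is_ideal I -> prodset I J `<=` I.
Proof. by rewrite prodsetC; exact: prodset_subr. Qed.

Lemma prod1set I : is_ideal I -> prodset setT I = I.
Proof.
move=> Iid; rewrite eqEsubset; split; first exact: prodset_subr.
by move=> x Ix; rewrite -[x]mul1r; exact: mem_prodset.
Qed.

Lemma prodset_principal c I : is_ideal I ->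
  prodset (scaleset c setT) I = scaleset c I.
Proof. by move=> Iid; rewrite prodset_scalel prod1set. Qed.

Lemma sumsetC I J : sumset I J = sumset J I.
Proof.
by rewrite eqEsubset; split=> _ [x Ix [y Jy <-]]; exists y => //; exists x;
   rewrite // addrC.
Qed.

Lemma sumsetA I J K : sumset I (sumset J K) = sumset (sumset I J) K.
Proof.
rewrite eqEsubset; split.
  move=> _ [x Ix [_ [y Jy [z Kz <-]] <-]].
  by exists (x + y); [exists x => //; exists y | exists z; rewrite ?addrA].
move=> _ [_ [x Ix [y Jy <-]] [z Kz <-]].
by exists x => //; exists (y + z); [exists y => //; exists z | rewrite addrA].
Qed.

Lemma sum0set I : sumset [set 0] I = I.
Proof.
rewrite eqEsubset; split; first by move=> _ [_ -> [y Iy <-]]; rewrite add0r.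
by move=> x Ix; exists 0 => //; exists x; rewrite ?add0r.
Qed.

Lemma sub_sumset I J L : add_stable L -> I `<=` L -> J `<=` L ->
  sumset I J `<=` L.
Proof.
by move=> [_ LD] IL JL _ [x Ix [y Jy <-]]; apply: LD; [exact: IL | exact: JL].
Qed.

Lemma sumset_subl I J : is_ideal J -> I `<=` sumset I J.
Proof. by move=> [J0 _ _] x Ix; exists x => //; exists 0; rewrite ?addr0. Qed.

Lemma sumset_subr I J : is_ideal I -> J `<=` sumset I J.
Proof. by rewrite sumsetC; exact: sumset_subl. Qed.

Lemma sumsetS I I' J J' : I `<=` I' -> J `<=` J' ->
  sumset I J `<=` sumset I' J'.
Proof.
by move=> II' JJ' _ [x /II' Ix [y /JJ' Jy <-]]; exists x => //; exists y.
Qed.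

Lemma sumset_idem I : is_ideal I -> sumset I I = I.
Proof.
move=> Iid; rewrite eqEsubset; split; last exact: sumset_subl.
by apply: sub_sumset => //; exact: ideal_add_stable.
Qed.

Lemma sumTset I : is_ideal I -> sumset setT I = setT.
Proof. by move=> Iid; rewrite eqEsubset; split => //; exact: sumset_subl. Qed.

Lemma prodset_sumsetl I J K :
  prodset (sumset I J) K `<=` sumset (prodset I K) (prodset J K).
Proof.
apply: sub_prodset.
  have [? IKD] := prodset_add_stable I K.
  have [? JKD] := prodset_add_stable J K.
  split; first by exists 0 => //; exists 0; rewrite ?addr0.
  move=> _ _ [x Ix [y Jy <-]] [x' Ix' [y' Jy' <-]].
  exists (x + x'); first exact: IKD.
  by exists (y + y'); [exact: JKD | rewrite addrACA].
move=> _ z [x Ix [y Jy <-]] Kz; rewrite mulrDl.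
exists (x * z); first exact: mem_prodset.
by exists (y * z); first exact: mem_prodset.
Qed.

End ProductOfSets.

(** * Invertible ideals *)

Section Invertible.
Variable A : idomainType.
Implicit Types (I J K : set A) (c d : A).

(** Invertibility as a fractional ideal, with the denominators of the inverse
d^-1 J cleared. *)
Definition invertible I :=
  exists J d, [/\ is_ideal J, d != 0 & prodset I J = scaleset d setT].

Lemma scaleset_sub_inj d I J : d != 0 ->
  scaleset d I `<=` scaleset d J -> I `<=` J.
Proof.
move=> d0 IJ x Ix; have [|y Jy /(mulfI d0) <- //] := IJ (d * x).
by exists x.
Qed.

Lemma scaleset_setI d I J : d != 0 ->
  scaleset d I `&` scaleset d J = scaleset d (I `&` J).
Proof.
move=> d0; rewrite eqEsubset; split=> [_ [[x Ix <-] [y Jy /(mulfI d0) yx]]|].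
  by exists x => //; split; rewrite // -yx.
by move=> _ [x [Ix Jx] <-]; split; exists x.
Qed.

Lemma invertible_principal c : c != 0 -> invertible (scaleset c setT).
Proof.
by move=> c0; exists setT, c; split=> //; rewrite prodset_principal.
Qed.

Lemma invertible_prodset I J :
  invertible I -> invertible J -> invertible (prodset I J).
Proof.
move=> [I' [c [I'id c0 II']]] [J' [d [J'id d0 JJ']]].
exists (prodset I' J'), (c * d); split; rewrite ?mulf_neq0 //.
  exact: ideal_prodset.
by rewrite prodsetACA II' JJ' prodset_principal ?scaleset_scaleset //;
   exact: ideal_scaleset.
Qed.

Lemma invertible_factor I J :
  is_ideal I -> invertible (prodset I J) -> invertible J.
Proof.
move=> Iid [K [d [Kid d0 IJK]]]; exists (prodset I K), d; split=> //.
  exact: ideal_prodset.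
by rewrite -IJK prodsetCA prodsetA.
Qed.

(** Adding generators one at a time, a finitely generated ideal is reached from
the zero ideal by sums of principal ideals. *)
Lemma span_ind (P : set A -> Prop) (s : seq A) :
    P [set 0] -> (forall c, P (scaleset c setT)) ->
    (forall I J, is_ideal I -> is_ideal J -> P I -> P J -> P (sumset I J)) ->
  P [set x | exists c : 'I_(size s) -> A, x = \sum_(i < size s) c i * s`_i].
Proof.
move=> P0 Pc PD; pose sp (s : seq A) : set A :=
  [set x | exists c : 'I_(size s) -> A, x = \sum_(i < size s) c i * s`_i].
suff [] : is_ideal (sp s) /\ P (sp s) by [].
elim: s => [|c s [IHid IH]].
  suff -> : sp [::] = [set 0] by split=> //; exact: ideal_set0.
  rewrite eqEsubset; split=> [_ [a ->]|_ ->]; first by rewrite big_ord0.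
  by exists (fun=> 0); rewrite big_ord0.
have cid : is_ideal (scaleset c setT) by exact: ideal_scaleset.
suff -> : sp (c :: s) = sumset (scaleset c setT) (sp s).
  by split; [exact: ideal_sumset | exact: PD].
rewrite eqEsubset; split.
  move=> _ [a ->]; rewrite big_ord_recl /= mulrC.
  exists (c * a ord0); first by exists (a ord0).
  exists (\sum_(i < size s) a (lift ord0 i) * s`_i) => //.
  by exists (fun i => a (lift ord0 i)).
move=> _ [_ [b _ <-] [_ [a ->] <-]].
exists (fun i => if unlift ord0 i is Some j then a j else b).
rewrite big_ord_recl /= unlift_none mulrC; congr (_ + _).
by apply: eq_bigr => i _; rewrite liftK.
Qed.

(** Invertibility passes to sums because I + J divides the invertible
ideal IJ. *)
Lemma noetherian_invertible : noetherian A ->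
    (forall I J, is_ideal I -> is_ideal J ->
       prodset (I `&` J) (sumset I J) = prodset I J) ->
  forall I, is_ideal I -> I <> [set 0] -> invertible I.
Proof.
move=> noeth joinM_meet I Iid I0; case: (noeth I Iid) => s Is.
suff [//|//] : I = [set 0] \/ invertible I.
rewrite Is; apply: (@span_ind (fun I => I = [set 0] \/ invertible I)).
- by left.
- move=> c; have [->|c0] := eqVneq c 0; last first.
    by right; exact: invertible_principal.
  left; rewrite eqEsubset; split=> [_ [x _ <-]|_ ->]; first by rewrite mul0r.
  by exists 0; rewrite ?mulr0.
- move=> J K Jid Kid [->|Jinv]; first by rewrite sum0set.
  move=> [->|Kinv]; first by rewrite sumsetC sum0set; right.
  right; apply: (@invertible_factor (J `&` K)); first exact: ideal_setI.
  by rewrite joinM_meet //; exact: invertible_prodset.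
Qed.

(** If K is d times the inverse of I, then M K is d times the quotient M / I,
which lies in dA as soon as M lies in I. *)
Lemma prodset_inverse_sub I K d M J :
    prodset I K = scaleset d setT -> M `<=` I -> is_ideal J ->
  prodset (prodset M K) J `<=` scaleset d J.
Proof.
move=> IK MI Jid; rewrite -(prodset_principal d Jid) -IK.
by apply: prodsetS => //; exact: prodsetS.
Qed.

Hypothesis inv_ideal : forall I, is_ideal I -> I <> [set 0] -> invertible I.

(** The inclusion of IJ in (I + J)(I `&` J) is the one that needs invertibility.
Let S = I + J and SK = dA.  Then d IJ = S (K I J), and K I J lies in both dI
and dJ since I and J lie in S. *)
Lemma setI_sumset_prodset I J : is_ideal I -> is_ideal J ->
  prodset (sumset I J) (I `&` J) = prodset I J.
Proof.
move=> Iid Jid; rewrite eqEsubset; split.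
  apply: classical_sets.subset_trans (@prodset_sumsetl _ _ _ _) _.
  apply: sub_sumset; first exact: prodset_add_stable.
    by apply: prodsetS => // x [].
  by rewrite (prodsetC I); apply: prodsetS => // x [].
have [S0|S0] := pselect (sumset I J = [set 0]).
  apply: sub_prodset; first exact: prodset_add_stable.
  move=> x y Ix Jy; have : sumset I J x by exact: sumset_subl.
  rewrite S0 => ->; rewrite mul0r.
  by case: (prodset_add_stable [set 0] (I `&` J)).
have [K [d [Kid d0 SK]]] := inv_ideal (ideal_sumset Iid Jid) S0.
have sub := fun M X => @prodset_inverse_sub _ _ _ M X SK.
apply: (scaleset_sub_inj d0).
rewrite -(prodset_principal d (ideal_prodset J Iid)) -SK -prodset_scaler.
rewrite -prodsetA; apply: prodsetS => //.
rewrite -scaleset_setI // classical_sets.subsetI; split.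
  rewrite [X in X `<=` _](_ : _ = prodset (prodset J K) I).
    by apply: sub => //; exact: sumset_subr.
  by rewrite prodsetCA prodsetC (prodsetC J).
rewrite prodsetA (prodsetC K).
by apply: sub => //; exact: sumset_subl.
Qed.

(** Let S = I + J, SL = dA and T = S `&` K.  Then dT = S L T is the sum of I L T
and J L T.  The first lies in dI because T lies in S, and in dK because I lies
in S and T in K; the second is symmetric. *)
Lemma setI_sumsetl I J K : is_ideal I -> is_ideal J -> is_ideal K ->
  sumset I J `&` K = sumset (I `&` K) (J `&` K).
Proof.
move=> Iid Jid Kid; rewrite eqEsubset; split; last first.
  apply: sub_sumset.
  - by apply: ideal_add_stable; apply: ideal_setI => //; exact: ideal_sumset.
  - by apply: setSI; exact: sumset_subl.
  - by apply: setSI; exact: sumset_subr.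
have [S0|S0] := pselect (sumset I J = [set 0]).
  move=> x [+ _]; rewrite S0 => ->.
  by case: (ideal_sumset (ideal_setI Iid Kid) (ideal_setI Jid Kid)).
have [L [d [Lid d0 SL]]] := inv_ideal (ideal_sumset Iid Jid) S0.
have sub := fun M X => @prodset_inverse_sub _ _ _ M X SL.
set T := sumset I J `&` K.
have Tid : is_ideal T by apply: ideal_setI => //; exact: ideal_sumset.
have part M : is_ideal M -> M `<=` sumset I J ->
    prodset (prodset M L) T `<=` scaleset d (M `&` K).
  move=> Mid MS; rewrite -scaleset_setI // classical_sets.subsetI; split.
    by rewrite -prodsetA prodsetC (prodsetC L); apply: sub => // x [].
  apply: classical_sets.subset_trans (sub _ _ MS Kid).
  by apply: prodsetS => // x [].
apply: (scaleset_sub_inj d0).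
rewrite -(prodset_principal d Tid) -SL -prodsetA.
apply: classical_sets.subset_trans (@prodset_sumsetl _ _ _ _) _.
apply: sub_sumset.
- apply: scaleset_add_stable; apply: ideal_add_stable.
  by apply: ideal_sumset; exact: ideal_setI.
- rewrite prodsetA; apply: classical_sets.subset_trans (part _ Iid _) _.
    exact: sumset_subl.
  by apply: image_subset; apply: sumset_subl; exact: ideal_setI.
- rewrite prodsetA; apply: classical_sets.subset_trans (part _ Jid _) _.
    exact: sumset_subr.
  by apply: image_subset; apply: sumset_subr; exact: ideal_setI.
Qed.

(** In any lattice, one distributive law implies the other. *)
Lemma sumset_setIl I J K : is_ideal I -> is_ideal J -> is_ideal K ->
  sumset (I `&` J) K = sumset I K `&` sumset J K.
Proof.
move=> Iid Jid Kid.
have IK := ideal_sumset Iid Kid; have JK := ideal_sumset Jid Kid.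
rewrite eqEsubset; split.
  by rewrite classical_sets.subsetI; split; apply: sumsetS => // x [].
rewrite setI_sumsetl //; apply: sub_sumset.
- by apply/ideal_add_stable/ideal_sumset => //; exact: ideal_setI.
- rewrite setIC setI_sumsetl // [J `&` I]setIC.
  by apply: sumsetS => // x [].
- by move=> x [Kx _]; apply: sumset_subr => //; exact: ideal_setI.
Qed.

End Invertible.

(** * Fractional ideals *)

Section FractionalIdeals.
Variable A : idomainType.
Local Notation K := {fraction A}.
Local Notation frac := (@FracField.tofrac A).
Implicit Types (I J : set A) (X Y : set K).

Definition embed I : set K := frac @` I.

Lemma embed_inj : injective embed.
Proof.
suff le I J : embed I = embed J -> I `<=` J.
  by move=> I J IJ; rewrite eqEsubset; split; exact: le.
move=> IJ x Ix; have : embed I (frac x) by exists x.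
by rewrite IJ => -[y Jy /eqP]; rewrite tofrac_eq => /eqP <-.
Qed.

Lemma embed_add_stable I : add_stable I -> add_stable (embed I).
Proof.
move=> [I0 ID]; split; first by exists 0; rewrite ?tofrac0.
move=> _ _ [x Ix <-] [y Iy <-]; exists (x + y); rewrite ?tofracD //.
exact: ID.
Qed.

Lemma embed_scaleset c I : embed (scaleset c I) = scaleset (frac c) (embed I).
Proof.
rewrite eqEsubset; split=> _ [_ [x Ix <-] <-].
  by exists (frac x); rewrite ?tofracM //; exists x.
by exists (c * x); rewrite ?tofracM //; exists x.
Qed.

Lemma embed_prodset I J : embed (prodset I J) = prodset (embed I) (embed J).
Proof.
rewrite eqEsubset; split.
  move=> _ [x IJx <-]; move: x IJx.
  have [st0 stD] := prodset_add_stable (embed I) (embed J).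
  apply: (@sub_prodset _ _ _ [set x | prodset (embed I) (embed J) (frac x)]).
    by split=> [|x y] /=; rewrite ?tofrac0 // tofracD; exact: stD.
  move=> x y Ix Jy /=; rewrite tofracM.
  by apply: mem_prodset; [exists x | exists y].
apply: sub_prodset; first exact/embed_add_stable/prodset_add_stable.
move=> _ _ [x Ix <-] [y Jy <-]; exists (x * y); rewrite ?tofracM //.
exact: mem_prodset.
Qed.

Lemma frac_neq0 (r : A) : r != 0 -> frac r != 0.
Proof. by rewrite tofrac_eq0. Qed.

(** Fractional ideals are the multiples of ideals of A, so their products are
computed in A up to a scalar. *)
Lemma fractional_idealP X :
  is_fractional_ideal X <->
  exists I r, [/\ is_ideal I, r != 0 & X = scaleset (frac r)^-1 (embed I)].
Proof.
split=> [[X0 XD XM [r r0 rX]]|[I [r [Iid r0 ->]]]].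
  exists [set x | scaleset (frac r) X (frac x)], r; split=> //.
    have [st0 stD] := scaleset_add_stable (frac r) (conj X0 XD).
    split=> /= [|x y|s x]; rewrite ?tofrac0 // ?tofracD ?tofracM.
      exact: stD.
    by move=> [z Xz <-]; exists (frac s * z); [exact: XM | rewrite mulrCA].
  rewrite eqEsubset; split.
    move=> x Xx; have [y ry] := rX x Xx; exists (frac r * x).
      by exists y; rewrite //= -ry; exists x.
    by rewrite mulKf ?frac_neq0.
  by move=> _ [_ [y [x Xx rx] <-] <-]; rewrite -rx mulKf ?frac_neq0.
have [st0 stD] := scaleset_add_stable (frac r)^-1
  (embed_add_stable (ideal_add_stable Iid)).
split=> //.
  move=> s _ [_ [x Ix <-] <-].
  exists (frac (s * x)); last by rewrite tofracM mulrCA.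
  by exists (s * x) => //; case: Iid => _ _; apply.
by exists r => // _ [_ [x Ix <-] <-]; exists x; rewrite mulVKf ?frac_neq0.
Qed.

Lemma fractional_embed I : is_ideal I -> is_fractional_ideal (embed I).
Proof.
move=> Iid; apply/fractional_idealP; exists I, 1; split; rewrite ?oner_eq0 //.
by rewrite tofrac1 invr1 scale1set.
Qed.

Lemma scaleset_eq0 (F : idomainType) (c : F) (S : set F) :
  c != 0 -> scaleset c S = [set 0] <-> S = [set 0].
Proof.
move=> c0; split=> [cS|->].
  have Sx x : S x -> x = 0.
    move=> Sx; have : scaleset c S (c * x) by exists x.
    by rewrite cS => /eqP; rewrite mulf_eq0 (negbTE c0) => /eqP.
  rewrite eqEsubset; split=> [x /Sx //|_ ->].
  have : scaleset c S 0 by rewrite cS.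
  by case=> x Sx' _; rewrite -(Sx _ Sx').
rewrite eqEsubset; split=> [_ [_ -> <-]|_ ->]; first by rewrite mulr0.
by exists 0; rewrite ?mulr0.
Qed.

Lemma embed_eq0 I : embed I = [set 0] <-> I = [set 0].
Proof.
have e0 : embed [set 0] = [set 0] by rewrite /embed image_set1 tofrac0.
by split=> [|->//]; rewrite -e0 => /embed_inj.
Qed.

(** The identity of the group can only be A: it is an A-submodule e with
A e = e, while A e = A because e is the identity.  Conversely, if I J = dA then
the inverse of r^-1 I is r d^-1 J. *)
Lemma dedekind_invertible :
  dedekind A <-> forall I, is_ideal I -> I <> [set 0] -> invertible I.
Proof.
have T0 : [set: A] <> [set 0].
  by move=> T0; have : [set: A] 1 by []; rewrite T0 => /eqP; rewrite oner_eq0.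
split=> [[_ _ [e [[efrac e0] eid einv]]] I Iid I0|inv].
  have eT : e = embed setT.
    have [r [J [Jid r0 eJ]]] := (fractional_idealP e).1 efrac.
    rewrite -[LHS](_ : prodset (embed setT) e = e).
      have [|//] := eid (embed setT).
      by split; [exact: fractional_embed | rewrite embed_eq0].
    rewrite eJ prodset_scaler -embed_prodset prod1set //.
  have [|Y [[Yfrac _] IY _]] := einv (embed I).
    by split; [exact: fractional_embed | rewrite embed_eq0].
  have [J [r [Jid r0 YJ]]] := (fractional_idealP Y).1 Yfrac.
  exists J, r; split=> //; apply: embed_inj.
  rewrite embed_prodset embed_scaleset -eT -IY YJ prodset_scaler.
  by rewrite scaleset_scaleset divff ?frac_neq0 // scale1set.
split.
- move=> X Y [/fractional_idealP[I [r [Iid r0 ->]]] X0].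
  move=> [/fractional_idealP[J [s [Jid s0 ->]]] Y0].
  rewrite prodset_scalel prodset_scaler -embed_prodset scaleset_scaleset.
  rewrite -invfM -tofracM.
  split.
    apply/fractional_idealP; exists (prodset I J), (r * s).
    by rewrite mulf_neq0 //; split=> //; exact: ideal_prodset.
  rewrite scaleset_eq0 ?invr_eq0 ?tofrac_eq0 ?mulf_neq0 // embed_eq0.
  move: X0 Y0; rewrite !scaleset_eq0 ?invr_eq0 ?tofrac_eq0 // !embed_eq0.
  move=> I0 J0.
  have [I' [c [_ c0 II']]] := inv I Iid I0.
  have [J' [d [_ d0 JJ']]] := inv J Jid J0.
  move=> IJ0.
  have : prodset (prodset I J) (prodset I' J') (c * d).
    rewrite prodsetACA II' JJ'.
    by apply: mem_prodset; [exists 1 | exists 1]; rewrite ?mulr1.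
  rewrite IJ0 => /(@prodset_subl _ _ _ (ideal_set0 A)) /eqP.
  by rewrite mulf_eq0 (negbTE c0) (negbTE d0).
- by move=> X Y Z _ _ _; exact: prodsetA.
exists (embed setT); split.
- by split; [exact: fractional_embed | rewrite embed_eq0].
- move=> X [/fractional_idealP[I [r [Iid r0 ->]]] _].
  rewrite (prodsetC _ (embed setT)).
  by rewrite prodset_scaler -embed_prodset prod1set.
move=> X [/fractional_idealP[I [r [Iid r0 XI]]] X0].
have I0 : I <> [set 0].
  by move: X0; rewrite XI scaleset_eq0 ?invr_eq0 ?tofrac_eq0 // embed_eq0.
have [J [d [Jid d0 IJ]]] := inv I Iid I0.
suff XY : prodset X (scaleset (frac d)^-1 (embed (scaleset r J))) = embed setT.
  exists (scaleset (frac d)^-1 (embed (scaleset r J))).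
  split; [split | exact: XY | by rewrite prodsetC].
    apply/fractional_idealP; exists (scaleset r J), d; split=> //.
    exact: ideal_scaleset.
  rewrite scaleset_eq0 ?invr_eq0 ?tofrac_eq0 // embed_eq0 scaleset_eq0 // => J0.
  have : scaleset d setT d by exists 1; rewrite ?mulr1.
  rewrite -IJ J0 => /(@prodset_subr _ _ _ (ideal_set0 A)) /eqP.
  by rewrite (negbTE d0).
rewrite XI prodset_scaler prodset_scalel embed_scaleset prodset_scaler.
rewrite -embed_prodset IJ embed_scaleset !scaleset_scaleset.
by rewrite mulfVK ?frac_neq0 // mulVf ?frac_neq0 // scale1set.
Qed.

End FractionalIdeals.

(** * The products of sums and intersections of a family of ideals *)

Section IdealFamilies.
Variable A : comPzRingType.

(** On arbitrary sets, setT is not neutral for products.  Bundling the ideals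
gives commutative monoids, for which iterated operations can be rearranged. *)
Record ideal := Ideal { ideal_set :> set A; ideal_setP : is_ideal ideal_set }.

Lemma ideal_inj : injective ideal_set.
Proof.
move=> [I Iid] [J Jid] /= IJ; rewrite IJ in Iid *.
by congr Ideal; exact: Prop_irrelevance.
Qed.

Definition ideal_one := Ideal (@ideal_setT A).
Definition ideal_zero := Ideal (@ideal_set0 A).
Definition ideal_mul (I J : ideal) := Ideal (ideal_prodset J (ideal_setP I)).
Definition ideal_add (I J : ideal) :=
  Ideal (ideal_sumset (ideal_setP I) (ideal_setP J)).
Definition ideal_cap (I J : ideal) :=
  Ideal (ideal_setI (ideal_setP I) (ideal_setP J)).

Fact ideal_mulA : associative ideal_mul.
Proof. by move=> I J L; apply: ideal_inj; exact: prodsetA. Qed.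
Fact ideal_mulC : commutative ideal_mul.
Proof. by move=> I J; apply: ideal_inj; exact: prodsetC. Qed.
Fact ideal_mul1 : left_id ideal_one ideal_mul.
Proof. by move=> I; apply: ideal_inj; apply: prod1set; exact: ideal_setP. Qed.
Fact ideal_addA : associative ideal_add.
Proof. by move=> I J L; apply: ideal_inj; exact: sumsetA. Qed.
Fact ideal_addC : commutative ideal_add.
Proof. by move=> I J; apply: ideal_inj; exact: sumsetC. Qed.
Fact ideal_add0 : left_id ideal_zero ideal_add.
Proof. by move=> I; apply: ideal_inj; exact: sum0set. Qed.
Fact ideal_capA : associative ideal_cap.
Proof. by move=> I J L; apply: ideal_inj; exact: setIA. Qed.
Fact ideal_capC : commutative ideal_cap.
Proof. by move=> I J; apply: ideal_inj; exact: setIC. Qed.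
Fact ideal_cap1 : left_id ideal_one ideal_cap.
Proof. by move=> I; apply: ideal_inj; exact: setTI. Qed.

HB.instance Definition _ :=
  Monoid.isComLaw.Build ideal ideal_one ideal_mul
    ideal_mulA ideal_mulC ideal_mul1.
HB.instance Definition _ :=
  Monoid.isComLaw.Build ideal ideal_zero ideal_add
    ideal_addA ideal_addC ideal_add0.
HB.instance Definition _ :=
  Monoid.isComLaw.Build ideal ideal_one ideal_cap
    ideal_capA ideal_capC ideal_cap1.

Lemma ideal_set_prod (I : Type) (r : seq I) (P : pred I) (F : I -> ideal) :
  ideal_set (\big[ideal_mul/ideal_one]_(i <- r | P i) F i) =
  \big[@prodset A/setT]_(i <- r | P i) ideal_set (F i).
Proof. exact: (big_morph ideal_set). Qed.

Variables (n : nat) (a : 'I_n -> ideal).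

Definition sum_of (S : {set 'I_n}) := \big[ideal_add/ideal_zero]_(i in S) a i.
Definition cap_of (S : {set 'I_n}) := \big[ideal_cap/ideal_one]_(i in S) a i.

Definition card_prod (F : {set 'I_n} -> ideal) (k : nat) :=
  \big[ideal_mul/ideal_one]_(S : {set 'I_n} | #|S| == k) F S.

Lemma GprodE k : Gprod a k = card_prod sum_of k.
Proof.
rewrite /card_prod ideal_set_prod; apply: eq_bigr => S _.
by rewrite /sum_of (big_morph ideal_set (id1 := [set 0]) (op1 := @sumset A)).
Qed.

Lemma LprodE k : Lprod a k = card_prod cap_of k.
Proof.
rewrite /card_prod ideal_set_prod; apply: eq_bigr => S _.
by rewrite /cap_of (big_morph ideal_set (id1 := setT) (op1 := setI)).
Qed.

Lemma card_prod_full F : card_prod F n = F finset.setT.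
Proof.
rewrite /card_prod (eq_bigl (pred1 finset.setT)) ?big_pred1_eq // => S /=.
rewrite eqEcard finset.subsetT /= cardsT card_ord.
by rewrite eqn_leq; have := max_card (mem S); rewrite card_ord => ->.
Qed.

Lemma card_prod1 F :
  card_prod F 1 = \big[ideal_mul/ideal_one]_(i < n) F (finset.set1 i).
Proof.
pose singletons : {set {set 'I_n}} := finset.set1 @: finset.setT.
rewrite /card_prod (eq_bigl (mem singletons)).
  rewrite big_imset; last by move=> i j _ _; exact: set1_inj.
  by apply: eq_bigl => i; rewrite finset.inE.
move=> S; apply/cards1P/imsetP => [[i ->]|[i _ ->]]; first by exists i.
by exists i.
Qed.

(** Exchanging the two products leaves, for each S, the single index
k = #|S|. *)
Lemma prod_by_card F (P : pred nat) m :
  \big[ideal_mul/ideal_one]_(m <= k < n.+1 | P k) card_prod F k =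
  \big[ideal_mul/ideal_one]_(S : {set 'I_n} | (m <= #|S|)%N && P #|S|) F S.
Proof.
rewrite /card_prod (exchange_big_dep xpredT) //= [RHS]big_mkcond.
apply: eq_bigr => S _.
rewrite (eq_bigl (fun k => P k && (k == #|S|))); last first.
  by move=> k; rewrite [k == _]eq_sym.
rewrite (big_nat1_cond_eq _ (fun=> F S)) ltnS.
by have := max_card (mem S); rewrite card_ord => ->; rewrite andbT.
Qed.

Lemma even_prodE F : even_prod n (fun k => ideal_set (card_prod F k)) =
  \big[ideal_mul/ideal_one]_(S : {set 'I_n} |
     (S \subset finset.setT) && ((S != finset.set0) && ~~ odd #|S|)) F S.
Proof.
rewrite /even_prod -(ideal_set_prod _ _ (card_prod F)) prod_by_card.
congr ideal_set; apply: eq_bigl => S; rewrite finset.subsetT -card_gt0.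
by case: #|S| => [|[]].
Qed.

Lemma odd_prodE F : odd_prod n (fun k => ideal_set (card_prod F k)) =
  \big[ideal_mul/ideal_one]_(S : {set 'I_n} |
     (S \subset finset.setT) && odd #|S|) F S.
Proof.
rewrite /odd_prod -(ideal_set_prod _ _ (card_prod F)) prod_by_card.
by congr ideal_set; apply: eq_bigl => S; rewrite finset.subsetT; case: #|S|.
Qed.

End IdealFamilies.

Lemma family_of_ideals (A : comPzRingType) (n : nat) (a : 'I_n -> set A) :
  (forall i, is_ideal (a i)) -> exists b : 'I_n -> ideal A, a = b.
Proof. by move=> aid; exists (fun i => Ideal (aid i)). Qed.

Lemma big_ord_setT (T : Type) (idx : T) (op : T -> T -> T) n (F : 'I_n -> T) :
  \big[op/idx]_(i in [set: 'I_n]%SET) F i = \big[op/idx]_(i < n) F i.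
Proof. by apply: eq_bigl => i; rewrite finset.inE. Qed.

Lemma inclusion_exclusion_ideals (A : idomainType) (n : nat)
    (a : 'I_n -> set A) :
    (forall I : set A, is_ideal I -> I <> [set 0] -> invertible I) ->
    (1 <= n)%N -> (forall i, is_ideal (a i)) ->
  prodset (Gprod a n) (even_prod n (Lprod a)) = odd_prod n (Lprod a) /\
  prodset (Lprod a n) (even_prod n (Gprod a)) = odd_prod n (Gprod a).
Proof.
move=> inv n_gt0 /family_of_ideals[b ->].
have T0 : [set: 'I_n]%SET != finset.set0 by rewrite -card_gt0 cardsT card_ord.
have -> : Lprod b = fun k => ideal_set (card_prod (cap_of b) k).
  by apply/funext => k; exact: LprodE.
have -> : Gprod b = fun k => ideal_set (card_prod (sum_of b) k).
  by apply/funext => k; exact: GprodE.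
rewrite !even_prodE !odd_prodE !card_prod_full; split.
  rewrite -(@inclusion_exclusion _ _ _ _
              (@ideal_mul A) (@ideal_add A) (@ideal_cap A)) //.
  - by move=> I; apply: ideal_inj; exact: setIid.
  - move=> I; apply: ideal_inj; rewrite /= eqEsubset.
    by split=> [x [] //|_ ->]; split=> //; case: (ideal_setP I).
  - move=> I J L; apply: ideal_inj.
    by apply: setI_sumsetl => //; exact: ideal_setP.
  - move=> I J; apply: ideal_inj.
    by apply: setI_sumset_prodset => //; exact: ideal_setP.
rewrite -(@inclusion_exclusion _ _ _ _
            (@ideal_mul A) (@ideal_cap A) (@ideal_add A)) //.
- by move=> I; apply: ideal_inj; apply: sumset_idem; exact: ideal_setP.
- by move=> I; apply: ideal_inj; apply: sumTset; exact: ideal_setP.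
- move=> I J L; apply: ideal_inj.
  by apply: sumset_setIl => //; exact: ideal_setP.
- move=> I J; apply: ideal_inj; rewrite /= prodsetC.
  by apply: setI_sumset_prodset => //; exact: ideal_setP.
Qed.

(** For two ideals the first identity reads (I + J)(I `&` J) = I J. *)
Lemma family_identity_pair (A : idomainType) :
    (forall (n : nat) (a : 'I_n -> set A),
       (1 <= n)%N -> (forall i, is_ideal (a i)) ->
       prodset (Gprod a n) (even_prod n (Lprod a)) = odd_prod n (Lprod a)) ->
  forall I J : set A, is_ideal I -> is_ideal J ->
    prodset (I `&` J) (sumset I J) = prodset I J.
Proof.
move=> eqG I J Iid Jid.
have aid (i : 'I_2) : is_ideal (if i == ord0 then I else J) by case: ifP.
have := eqG 2%N _ isT aid; have [b ab] := family_of_ideals aid; rewrite ab.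
have -> : Lprod b = fun k => ideal_set (card_prod (cap_of b) k).
  by apply/funext => k; exact: LprodE.
rewrite GprodE card_prod_full /even_prod /odd_prod.
have toI := ideal_set_prod _ _ (card_prod (cap_of b)).
rewrite -toI -toI /index_iota /= !big_cons !big_nil /=.
rewrite card_prod_full card_prod1 /sum_of /cap_of !big_ord_setT.
rewrite !big_ord_recl !big_ord0 !big_set1 !Monoid.mulm1 /=.
have b0 : I = b ord0 by rewrite -(congr1 (@^~ ord0) ab).
have b1 : J = b (lift ord0 ord0) by rewrite -(congr1 (@^~ (lift ord0 ord0)) ab).
by rewrite -b0 -b1 !(prodsetC _ setT) !prod1set //;
   [rewrite prodsetC | exact: ideal_prodset | exact: ideal_setI].
Qed.

Theorem theorem3p2 (A : idomainType) (A_noeth : noetherian A) :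
  [<-> dedekind A;
       forall (n : nat) (a : 'I_n -> set A),
         (1 <= n)%N -> (forall i, is_ideal (a i)) ->
         prodset (Gprod a n) (even_prod n (Lprod a)) = odd_prod n (Lprod a) /\
         prodset (Lprod a n) (even_prod n (Gprod a)) = odd_prod n (Gprod a);
       forall a1 a2 : set A, is_ideal a1 -> is_ideal a2 ->
         prodset (a1 `&` a2) (sumset a1 a2) = prodset a1 a2].
Proof.
tfae.
- move=> /dedekind_invertible inv n a; exact: inclusion_exclusion_ideals.
- move=> eqs; apply: family_identity_pair => n a n_gt0 aid.
  by have [] := eqs n a n_gt0 aid.
- by move=> joinM_meet; apply/dedekind_invertible; exact: noetherian_invertible.
Qed.
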